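(* Let $n\ge 1$, $r\ge 1$ and $k$ be integers. (i) If $n$ is odd, $0\le k<n+2$, $r\ge n+2$, and $r\equiv k\pmod{n+2}$, then $$\mathcal{D}(L_n,r)\le \frac{(n+2)^{n-1}}{2^{n}(r-k)^{n-1}}.$$ (ii) If $n$ is even, $0\le k<(n+2)/2$, $r\ge (n+2)/2$, and $r\equiv k\pmod{(n+2)/2}$, then $$\mathcal{D}(L_n,r)\le \frac{(n+2)^{n-1}}{2^{n}(r-k)^{n-1}}.$$
   Context: $L_n$ denotes the $n$-dimensional lattice graph: its vertex set is $\mathbb{Z}^n$, and $\{(x_1,\ldots,x_n),(y_1,\ldots,y_n)\}$ is an edge if and only if $\sum_{i=1}^n |x_i-y_i|=1$. For a connected undirected graph $G$ with graph distance $d$, put $B_r(v)=\{u\in V(G): d(u,v)\le r\}$. A code is a nonempty subset $C\subseteq V(G)$. A code $C$ is $r$-identifying if (1) $B_r(v)\cap C\neq\emptyset$ for all $v\in V(G)$, and (2) $B_r(u)\cap C\ne B_r(v)\cap C$ for all $u\neq v$ in $V(G)$. The density of a code $C$ in $L_n$ is $\limsup_{m\to\infty} |C\cap Q_m|/|Q_m|$, where $Q_m$ is the set of $(x_1,\ldots,x_n)\in\mathbb{Z}^n$ with $|x_i|\le m$ for all $i$. $\mathcal{D}(L_n,r)$ denotes the minimum possible density (the infimum over all $r$-identifying codes) of an $r$-identifying code for $L_n$. *)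

(* Defs.v *)
From HB Require Import structures.
From mathcomp Require Import all_boot all_order all_algebra.
From mathcomp Require Import finmap.
From mathcomp Require Import boolp classical_sets functions cardinality.
From mathcomp Require Import reals ereal sequences.
Set Implicit Arguments.
Unset Strict Implicit.
Unset Printing Implicit Defensive.
Import Order.TTheory GRing.Theory Num.Theory.
Local Open Scope classical_set_scope.
Local Open Scope ring_scope.

Record connected_graph := ConnectedGraph {
  vertex :> choiceType;
  adj : rel vertex;
  adj_irr : irreflexive adj;
  adj_sym : symmetric adj;
  adj_conn : forall x y : vertex, exists p : seq vertex,
    path adj x p /\ last x p = y }.

Section IdentifyingCodes.
Variable G : connected_graph.

(* The walk visits x followed by the vertices of p, so size p is its number
   of edges. *)
Definition walk_of_length (x y : G) (l : nat) : Prop :=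
  exists p : seq G, [/\ path (@adj G) x p, last x p = y & size p = l].

Lemma ex_walk (x y : G) : exists l : nat, `[< walk_of_length x y l >].
Proof.
by have [p [xp py]] := adj_conn x y; exists (size p); apply/asboolP; exists p.
Qed.

Definition dist (x y : G) : nat := ex_minn (ex_walk x y).

Definition gball (r : nat) (v : G) : set G := [set u | (dist u v <= r)%N].

Definition code (C : set G) : Prop := C !=set0.

Definition identifying (r : nat) (C : set G) : Prop :=
  [/\ code C,
      forall v : G, gball r v `&` C !=set0 &
      forall u v : G, u <> v -> gball r u `&` C <> gball r v `&` C].

End IdentifyingCodes.

Definition lattice_adj (n : nat) : rel 'rV[int]_n :=
  fun x y => \sum_(i < n) `|x 0 i - y 0 i| == 1.

Lemma lattice_irr n : irreflexive (@lattice_adj n).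
Proof.
by move=> x; rewrite /lattice_adj big1// => i _; rewrite subrr normr0.
Qed.

Lemma lattice_sym n : symmetric (@lattice_adj n).
Proof.
by move=> x y; congr (_ == _); apply: eq_bigr => i _; rewrite distrC.
Qed.

Lemma lattice_conn n (x y : 'rV[int]_n) : exists p : seq 'rV[int]_n,
  path (@lattice_adj n) x p /\ last x p = y.
Proof.
have [N] : exists N : nat, \sum_(i < n) `|x 0 i - y 0 i| = N%:Z.
  exists `|(\sum_(i < n) `|x 0 i - y 0 i|)%R|%N.
  by rewrite gez0_abs// sumr_ge0.
elim: N x => [x s0|N IH x sN].
  exists [::]; split=> //=; apply/rowP => i; apply/eqP; rewrite -subr_eq0.
  rewrite -normr_eq0; move/eqP: s0; rewrite psumr_eq0// => /allP/(_ i).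
  by apply; rewrite mem_index_enum.
case: (pickP (fun i => x 0 i != y 0 i)) => [i xyi|xy]; last first.
  by move: sN; rewrite big1// => i _; move/negbFE/eqP: (xy i) => ->;
    rewrite subrr normr0.
pose x' : 'rV[int]_n := x - Num.sg (x 0 i - y 0 i) *: delta_mx 0 i.
have x'i : x' 0 i = x 0 i - Num.sg (x 0 i - y 0 i).
  by rewrite !mxE !eqxx mulr1.
have x'j j : j != i -> x' 0 j = x 0 j.
  by move=> ji; rewrite !mxE eqxx (negbTE ji) mulr0 subr0.
have d0 : x 0 i - y 0 i != 0 by rewrite subr_eq0.
have x'y : \sum_(j < n) `|x' 0 j - y 0 j| = N%:Z.
  move: sN; rewrite (bigD1 i)//= [in RHS](_ : N.+1%:Z = 1 + N%:Z)// => sN.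
  apply: (addrI 1); rewrite -sN (bigD1 i)//= addrA; congr (_ + _); last first.
    by apply: eq_bigr => j ji; rewrite x'j.
  rewrite x'i addrAC; move: (x 0 i - y 0 i) d0 => d d0.
  rewrite {1}[d]numEsg -[X in _ * _ - X]mulr1 -mulrBr normrM normr_sg d0 mul1r.
  by rewrite ger0_norm ?subr_ge0 -?gtz0_ge1 ?normr_gt0// addrC subrK.
have [p [x'p py]] := IH _ x'y.
exists (x' :: p); split=> //=; rewrite x'p andbT /lattice_adj (bigD1 i)//=.
rewrite big1 ?addr0; last by move=> j ji; rewrite x'j// subrr normr0.
by rewrite x'i opprB addrC subrK normr_sg d0.
Qed.

Definition lattice (n : nat) : connected_graph :=
  ConnectedGraph (@lattice_irr n) (@lattice_sym n) (@lattice_conn n).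

Definition box (n m : nat) : set (lattice n) :=
  [set x : 'rV[int]_n | forall i, `|x 0 i| <= m%:Z].

(* fset_set returns the empty finite set on an infinite set; the lemma
   finite_box rules this out in the cardinalities used by density. *)
Lemma finite_box n m : finite_set (@box n m).
Proof.
pose f (g : {ffun 'I_n -> 'I_(m + m).+1}) : lattice n :=
  (\row_i ((g i : nat)%:Z - m%:Z) : 'rV[int]_n).
apply: (@sub_finite_set _ _ (f @` setT)); last first.
  exact/finite_image/finite_finset.
move=> x xm; exists [ffun i => inord `|(x 0 i + m%:Z)%R|%N] => //.
apply/rowP => i; rewrite !mxE ffunE.
have := xm i; rewrite ler_norml => /andP[lo hi].
have ge0 : 0 <= x 0 i + m%:Z by rewrite -lerBlDr sub0r.
rewrite inordK ?gez0_abs ?addrK//.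
by rewrite ltnS -lez_nat gez0_abs// PoszD lerD2r.
Qed.

Definition density (R : realType) (n : nat) (C : set (lattice n)) : \bar R :=
  limn_esup (fun m : nat =>
    ((#|` fset_set (C `&` @box n m)|)%:R / (#|` fset_set (@box n m)|)%:R)%:E).

Definition min_density (R : realType) (n r : nat) : \bar R :=
  ereal_inf [set density R C | C in [set C : set (lattice n) | identifying r C]].

(* Main.v *)
Require Import Defs.
From mathcomp Require Import all_boot all_order all_algebra finmap.
From mathcomp Require Import zify ring lra.
From mathcomp Require Import boolp classical_sets cardinality.
From mathcomp Require Import reals ereal normedtype sequences realfun.
Set Implicit Arguments.
Unset Strict Implicit.
Unset Printing Implicit Defensive.
Import Order.TTheory GRing.Theory Num.Theory.
Import numFieldNormedType.Exports.
Local Open Scope classical_set_scope.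
Local Open Scope ring_scope.

(* Put [(n + 2) d = 2 (r - k)]; the bound is then [1 / (2 d^(n-1))]. The code
   consists of the points with even coordinate sum on the lines [Z x {p}], [p]
   in [(d Z)^(n-1)]. On such a line the ball of radius [r] around [u] cuts out
   an interval centered at [u_0] of radius [r - |u' - p|], where [u'] drops the
   coordinate [u_0]; the ends of this interval can be code points iff
   [r + sum u] is even. Hence [p] separates [u] from [v] as soon as the gain
   [|v' - p| - |u' - p| + |v_0 - u_0|] is at least 2, or equals 1 with
   [r + sum u] even. If [u_i < v_i], take two points [p] that differ only in
   coordinate [i], by [d], bracket [u_i] and are otherwise nearest to [u']:
   the gain of [u] over [v] at the first and that of [v] over [u] at the second
   add up to at least 2. If both are 1, then [sum u] and [sum v] have different
   parities, so that one of the two separates. *)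

(** * Graph distance in the lattice as l1 distance *)

Definition l1 n (x y : 'rV[int]_n) : int := \sum_(i < n) `|x 0 i - y 0 i|.

Lemma l1C n (x y : 'rV[int]_n) : l1 x y = l1 y x.
Proof. by apply: eq_bigr => i _; rewrite distrC. Qed.

Lemma l1_ge0 n (x y : 'rV[int]_n) : 0 <= l1 x y.
Proof. exact: sumr_ge0. Qed.

Lemma l1_triangle n (y x z : 'rV[int]_n) : l1 x z <= l1 x y + l1 y z.
Proof. by rewrite -big_split; apply: ler_sum => i _; exact: ler_distD. Qed.

Lemma l1xx n (x : 'rV[int]_n) : l1 x x = 0.
Proof. by apply: big1 => i _; rewrite subrr normr0. Qed.

Lemma l1_eq0 n (x y : 'rV[int]_n) : l1 x y = 0 -> x = y.
Proof.
move=> /eqP; rewrite psumr_eq0// => /allP xy; apply/rowP => i.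
by have := xy i (mem_index_enum i); rewrite normr_eq0 subr_eq0 => /eqP.
Qed.

(** A unit move towards [y] along any coordinate where [x] and [y] differ. Iterating it yields a
    walk of length exactly [l1 x y]. *)
Lemma l1_step n (x y : 'rV[int]_n) (l : nat) : l1 x y = l.+1%:Z ->
  exists2 z, l1 x z = 1 & l1 z y = l%:Z.
Proof.
move=> xyl; have [i xyi|xy] := pickP (fun i => x 0 i != y 0 i); last first.
  by move: xyl; rewrite (_ : y = x) ?l1xx//; apply/rowP => i; move/eqP: (xy i).
exists (x + Num.sg (y 0 i - x 0 i) *: delta_mx 0 i).
  rewrite /l1 (bigD1 i)//= big1 ?addr0.
    rewrite !mxE !eqxx mulr1; move: (x 0 i) (y 0 i) xyi => a b ab.
    by case: sgrP => ?; lia.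
  by move=> j /negPf ji; rewrite !mxE eqxx ji mulr0 addr0 subrr normr0.
move: xyl; rewrite /l1 !(bigD1 i (P := xpredT))//= !mxE !eqxx.
under [in X in _ -> X]eq_bigr => j /negPf ji.
  by rewrite !mxE eqxx ji mulr0 addr0; over.
move: (\sum_(j < n | _) _) (x 0 i) (y 0 i) xyi => s a b ab.
by rewrite mulr1; case: sgrP => ?; lia.
Qed.

Lemma walk_l1 n (x y : lattice n) l : walk_of_length x y l -> l1 x y <= l%:Z.
Proof.
case=> p [xp <- <-] {y l}; elim: p x xp => [x _|z p IH x /= /andP[xz zp]].
  by rewrite l1xx.
apply: le_trans (l1_triangle z _ _) _.
by move/eqP: xz; rewrite -/(l1 x z) => ->; rewrite intS lerD2l IH.
Qed.

Lemma l1_walk n (x y : lattice n) (l : nat) :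
  l1 x y = l%:Z -> walk_of_length x y l.
Proof.
elim: l x => [x /l1_eq0 ->|l IH x /l1_step[z xz /IH[p [zp pl sp]]]].
  by exists [::].
by exists (z :: p); split=> //=; rewrite ?sp// zp andbT; apply/eqP.
Qed.

Lemma gball_latticeE n r (u v : lattice n) :
  gball r v u <-> l1 u v <= r%:Z.
Proof.
rewrite /gball /= /dist; case: ex_minnP => l /asboolP uvl lmin; split.
  by have := walk_l1 uvl; lia.
have [m uvm] : exists m : nat, l1 u v = m%:Z.
  by exists `|l1 u v|%N; rewrite gez0_abs// l1_ge0.
by have /asboolT/lmin := l1_walk uvm; lia.
Qed.

(** * The code on parallel lines and separation along one line *)

Definition line_dist n (u : 'rV[int]_n.+1) (p : 'I_n -> int) : int :=
  \sum_(i < n) `|u 0 (lift ord0 i) - p i|.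

Definition line_code n (d : nat) : set (lattice n.+1) :=
  [set x : 'rV[int]_n.+1 | (forall i : 'I_n, (d %| x 0%R (lift ord0 i))%Z) /\
    (2 %| (\sum_i x 0 i)%R)%Z].

Definition line_point n (a : int) (p : 'I_n -> int) : 'rV[int]_n.+1 :=
  \row_i if unlift ord0 i is Some j then p j else a.

Lemma line_point0 n a (p : 'I_n -> int) : line_point a p 0 ord0 = a.
Proof. by rewrite mxE unlift_none. Qed.

Lemma line_pointS n a (p : 'I_n -> int) i :
  line_point a p 0 (lift ord0 i) = p i.
Proof. by rewrite mxE liftK. Qed.

Lemma l1_line_point n a (p : 'I_n -> int) u :
  l1 (line_point a p) u = `|u 0 ord0 - a| + line_dist u p.
Proof.
rewrite l1C /l1 big_ord_recl line_point0; congr (_ + _).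
by apply: eq_bigr => i _; rewrite line_pointS.
Qed.

(** Termwise, |a - b| + a + b is even. This decides which points of a line at a given distance from
    [u] can belong to the code. *)
Lemma line_dist_parity n (u : 'rV[int]_n.+1) (p : 'I_n -> int) :
  (2 %| (line_dist u p + \sum_(i < n) u 0 (lift ord0 i) +
    \sum_(i < n) p i)%R)%Z.
Proof. by rewrite -!big_split; apply: rpred_sum => i _ /=; lia. Qed.

Lemma line_dist_ge0 n (u : 'rV[int]_n.+1) (p : 'I_n -> int) :
  0 <= line_dist u p.
Proof. exact: sumr_ge0. Qed.

(* [c] lies on the line over [p] at distance [r] or [r - 1] from [u],
   whichever the parity of [\sum_i u 0 i] allows, on the side away from [v]. *)
Lemma line_code_separates n (d r : nat) (u v : 'rV[int]_n.+1)
    (p : 'I_n -> int) :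
    (forall i, (d %| p i)%Z) -> line_dist u p < r%:Z ->
    2 <= line_dist v p - line_dist u p + `|v 0 ord0 - u 0 ord0| +
      (2 %| (\sum_i u 0 i + r%:Z)%R)%Z%:Z ->
  exists c, [/\ line_code d c, l1 c u <= r%:Z & r%:Z < l1 c v].
Proof.
move=> dp pr gain; have par := line_dist_parity u p.
have u0 := line_dist_ge0 u p.
have [a [Ca ua va]] : exists a : int, [/\ (2 %| (a + \sum_i p i)%R)%Z,
    `|u 0 ord0 - a| + line_dist u p <= r%:Z &
    r%:Z < `|v 0 ord0 - a| + line_dist v p].
  move: par gain u0 pr; rewrite big_ord_recl.
  move: (line_dist u p) (line_dist v p) (u 0 ord0) (v 0 ord0) => L L' U U'.
  move: (\sum_i p i) (\sum_(i < n) _) => P W par gain u0 pr.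
  (* Since [L + W + P] is even, subtracting the remainder makes both [U - t + P] and [U + t + P]
     even. As [L < r], [t] stays nonnegative even when the remainder is 1. *)
  pose t : int := r%:Z - L - ((U + W + r%:Z)%R %% 2)%Z.
  have [UU'|UU'] := leP U U'; [exists (U - t)|exists (U + t)].
    by split; rewrite /t; lia.
  by split; rewrite /t; lia.
exists (line_point a p); split; rewrite ?l1_line_point//.
split=> [i|]; first by rewrite line_pointS.
rewrite big_ord_recl line_point0.
by under eq_bigr do rewrite line_pointS.
Qed.

(** * Lines near a point and the identifying property *)

Lemma floor_multiple (d : nat) (a : int) : (0 < d)%N ->
  exists2 q : int, (d %| q)%Z & q <= a < q + d%:Z.
Proof.
move=> d0; exists (divz a d * d); first exact: dvdz_mull.
have := divz_eq a d; have := modz_ge0 a (d := d); have := ltz_pmod a (d := d).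
by move: (modz _ _) (divz _ _ * _) => s q; lia.
Qed.

Lemma nearest_multiple (d : nat) (a : int) : (0 < d)%N ->
  exists2 q : int, (d %| q)%Z & 2 * `|a - q| <= d%:Z.
Proof.
move=> /(floor_multiple a)[q dq qa].
have [aq|aq] := leP (2 * (a - q)) d%:Z; first by exists q => //; lia.
by exists (q + d%:Z); [rewrite rpredD ?dvdzz|lia].
Qed.

Lemma nearest_line n (d : nat) (u : 'rV[int]_n.+1) : (0 < d)%N ->
  exists p : 'I_n -> int, (forall j, (d %| p j)%Z) /\
    forall j, 2 * `|u 0 (lift ord0 j) - p j| <= d%:Z.
Proof.
move=> d0; have /choice[p pP] (j : 'I_n) : exists q : int,
    (d %| q)%Z /\ 2 * `|u 0 (lift ord0 j) - q| <= d%:Z.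
  by have [q] := nearest_multiple (u 0 (lift ord0 j)) d0; exists q.
by exists p; split=> j; case: (pP j).
Qed.

Lemma line_dist_nearest n (d : nat) (u : 'rV[int]_n.+1) (p : 'I_n -> int) :
    (forall j, 2 * `|u 0 (lift ord0 j) - p j| <= d%:Z) ->
  2 * line_dist u p <= (n * d)%N%:Z.
Proof.
move=> up; rewrite mulr_sumr; apply: (@le_trans _ _ (\sum_(j < n) d%:Z)).
  exact: ler_sum.
by rewrite sumr_const card_ord -mulr_natl PoszM natz.
Qed.

Lemma ball_line_code_neq n (d r : nat) (u v : 'rV[int]_n.+1) :
    (0 < d)%N -> (n.+1 * d < 2 * r)%N -> u != v ->
  exists2 c, line_code d c & (l1 c u <= r%:Z) != (l1 c v <= r%:Z).
Proof.
move=> d0 dr uv.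
have sep (x y : 'rV[int]_n.+1) p : (forall i, (d %| p i)%Z) ->
    line_dist x p < r%:Z ->
    2 <= line_dist y p - line_dist x p + `|y 0 ord0 - x 0 ord0| +
      (2 %| (\sum_i x 0 i + r%:Z)%R)%Z%:Z ->
    exists2 c, line_code d c & (l1 c x <= r%:Z) != (l1 c y <= r%:Z).
  move=> dp xr /(line_code_separates dp xr)[c [Cc cx]].
  by rewrite ltNge => /negPf cy; exists c; rewrite // cx cy.
have sepC (x y : 'rV[int]_n.+1) :
    (exists2 c, line_code d c & (l1 c x <= r%:Z) != (l1 c y <= r%:Z)) ->
    exists2 c, line_code d c & (l1 c y <= r%:Z) != (l1 c x <= r%:Z).
  by case=> c Cc; rewrite eq_sym; exists c.
have [i uvi|uv_eq] :=
  pickP (fun i : 'I_n => u 0 (lift ord0 i) != v 0 (lift ord0 i)).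
  wlog {uv uvi} uvi : u v / u 0 (lift ord0 i) < v 0 (lift ord0 i).
    move=> H; move: uvi; rewrite neq_lt => /orP[|vu]; first exact: H.
    exact/sepC/H.
  have [p [dp up]] := nearest_line u d0.
  pose pi a j : int := if j == i then a else p j.
  have pid a : (d %| a)%Z -> forall j, (d %| pi a j)%Z.
    by move=> da j; rewrite /pi; case: ifP.
  pose rest (x : 'rV[int]_n.+1) : int :=
    \sum_(j < n | j != i) `|x 0 (lift ord0 j) - p j|.
  have piE x a : line_dist x (pi a) = `|x 0 (lift ord0 i) - a| + rest x.
    rewrite /line_dist (bigD1 i)//= /pi eqxx; congr (_ + _).
    by apply: eq_bigr => j /negPf ->.
  (* The n - 1 coordinates other than [i] contribute at most d/2 each. With |u_i - Q| < d, the
     distance from [u] to the line at [Q] is below (n + 1) d / 2, hence below [r]. *)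
  have rest_u : 2 * rest u + d%:Z <= (n * d)%N%:Z.
    rewrite mulr_sumr; apply: (@le_trans _ _ (\sum_(j < n) d%:Z)).
      by rewrite [leRHS](bigD1 i)//= [leLHS]addrC lerD2l ler_sum.
    by rewrite sumr_const card_ord -mulr_natl PoszM natz.
  have [Q dQ Qu] := floor_multiple (u 0 (lift ord0 i)) d0.
  have dQd : (d %| (Q + d%:Z)%R)%Z by rewrite rpredD ?dvdzz.
  have := sep u v _ (pid _ dQ).
  have := fun vr g => sepC _ _ (sep v u _ (pid _ dQd) vr g).
  have := line_dist_parity u (pi Q); have := line_dist_parity v (pi Q).
  rewrite !piE ![\sum_i _ 0 i]big_ord_recl.
  move: (exists2 c, _ & _) => P.
  have : 0 <= rest v by apply: sumr_ge0.
  move: (\sum_(j < n) pi Q j) (\sum_(j < n) u 0 (lift ord0 j))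
    (\sum_(j < n) v 0 (lift ord0 j)) => sp su sv.
  move: (rest u) (rest v) (u 0 ord0) (v 0 ord0) rest_u => Ru Rv u0 v0 rest_u.
  move: (u 0 (lift ord0 i)) (v 0 (lift ord0 i)) uvi Qu => ui vi.
  move=> uvi Qu Rv0 pv pu sv2 sv1.
  (* If [u] does not succeed at [Q], its gain there is at most 1. This also bounds [Rv] in terms of
     [Ru], which brings [v] within distance less than [r] of the line at [Q + d]. *)
  have [g1|g1] := leP 2 (`|vi - Q| + Rv - (`|ui - Q| + Ru) + `|v0 - u0| +
      (2 %| (u0 + su + r%:Z)%R)%Z%:Z).
    by apply: sv1 => //; lia.
  by apply: sv2; lia.
(* Here [u] and [v] differ only in coordinate 0, so one nearest line serves both and the gain is
   |v_0 - u_0| in either direction. If it is 1, the coordinate sums have opposite parities and one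
   direction succeeds. *)
have [p [dp up]] := nearest_line u d0; have := line_dist_nearest up.
have uvp : line_dist v p = line_dist u p.
  by apply: eq_bigr => i _; move/negbFE/eqP: (uv_eq i) => ->.
have uv0 : u 0 ord0 != v 0 ord0.
  apply: contraNneq uv => uv0; apply/eqP/rowP => i.
  by case: (unliftP ord0 i) => [j|] -> //; move/negbFE/eqP: (uv_eq j).
have := sep u v _ dp; have := fun vr g => sepC _ _ (sep v u _ dp vr g).
have := line_dist_parity u p; have := line_dist_parity v p.
rewrite uvp ![\sum_i _ 0 i]big_ord_recl.
move: (exists2 c, _ & _) => P.
move: (\sum_(j < n) p j) (\sum_(j < n) u 0 (lift ord0 j))
  (\sum_(j < n) v 0 (lift ord0 j)) => sp su sv.
move: (line_dist u p) (u 0 ord0) (v 0 ord0) uv0 => L u0 v0 uv0 pv pu sv2 sv1 Ld.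
have Lr : L < r%:Z by lia.
have [g1|g1] := leP 2 (`|v0 - u0| + (2 %| (u0 + su + r%:Z)%R)%Z%:Z).
  by apply: sv1 => //; lia.
by apply: sv2 => //; lia.
Qed.

Lemma line_code_identifying n d r : (0 < d)%N -> (n.+1 * d < 2 * r)%N ->
  identifying r (@line_code n d).
Proof.
move=> d0 dr; have C0 : line_code d (0 : 'rV[int]_n.+1).
  by split=> [i|]; [rewrite mxE dvdz0|rewrite big1// => i _; rewrite mxE].
split; first by exists (0 : 'rV[int]_n.+1).
- move=> v; have [p [dp vp]] := nearest_line v d0.
  have vr := line_dist_nearest vp.
  (* Separating [v] from any point whose gain is 2 puts a code point in the
     ball of [v]. *)
  pose v' : 'rV[int]_n.+1 := \row_i if i == ord0 then v 0 ord0 + 2 else v 0 i.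
  have v'p : line_dist v' p = line_dist v p.
    by apply: eq_bigr => i _; rewrite mxE.
  have [||c [Cc cv _]] := @line_code_separates n d r v v' p dp.
  + by move: (line_dist v p) vr => L; lia.
  + rewrite v'p mxE eqxx.
    by move: (line_dist v p) (v 0 ord0) (nat_of_bool _) => L v0 b; lia.
  by exists c; split=> //; apply/gball_latticeE.
- move=> u v /eqP uv; have [c Cc cuv] := ball_line_code_neq d0 dr uv.
  have inB x : (gball r x `&` line_code d) c <-> l1 c x <= r%:Z.
    by split=> [[/gball_latticeE]//|cx]; split=> //; apply/gball_latticeE.
  move=> BuBv; move/negP: cuv; apply; apply/eqP; apply/idP/idP => /inB.
    by rewrite BuBv => /inB.
  by rewrite -BuBv => /inB.
Qed.

(** * Counting code points in boxes, and the density *)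

Lemma leq_card_fset_set (T : finType) (U : choiceType) (A : set U)
    (f : T -> U) :
  finite_set A -> injective f -> (forall t, A (f t)) ->
  (#|T| <= #|` fset_set A|)%N.
Proof.
move=> finA f_inj Af; rewrite cardE -(size_map f); apply: uniq_leq_size.
  by rewrite map_inj_uniq ?enum_uniq.
by move=> _ /mapP[t _ ->]; rewrite in_fset_set// inE.
Qed.

Lemma card_fset_set_leq (T : finType) (U : choiceType) (A : set U)
    (f : T -> U) :
  A `<=` range f -> (#|` fset_set A| <= #|T|)%N.
Proof.
move=> Af; have finA : finite_set A.
  by apply: sub_finite_set Af _; exact/finite_image/finite_finset.
rewrite cardE -(size_map f); apply: uniq_leq_size => // x.
rewrite in_fset_set// inE => /Af[t _ <-].
by rewrite map_f// mem_enum.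
Qed.

Lemma card_box_ge n m : ((2 * m).+1 ^ n <= #|` fset_set (@box n m)|)%N.
Proof.
pose f (g : {ffun 'I_n -> 'I_(2 * m).+1}) : lattice n :=
  (\row_i ((g i : nat)%:Z - m%:Z) : 'rV[int]_n).
have f_inj : injective f.
  move=> g h /rowP gh; apply/ffunP => i; apply: val_inj => /=.
  by have := gh i; rewrite !mxE => /addIr[].
rewrite -[X in (_ ^ X)%N]card_ord -[X in (X ^ _)%N]card_ord -card_ffun.
apply: leq_card_fset_set f_inj _; first exact: finite_box.
by move=> g i; rewrite mxE; case: (g i) => k /= kl; lia.
Qed.

Lemma card_line_code_box n d m : (0 < d)%N ->
  (#|` fset_set (@line_code n d `&` @box n.+1 m)| <=
    (2 * (m %/ d)).+1 ^ n * m.+1)%N.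
Proof.
move=> d0; pose K := (m %/ d)%N.
pose p (g : {ffun 'I_n -> 'I_(2 * K).+1}) i : int :=
  ((g i : nat)%:Z - K%:Z) * d%:Z.
(* The remainder added to 2 g - m makes the coordinate sum even. The parametrization may overshoot
   the box by one, which is harmless for an upper bound. *)
pose f (g : {ffun 'I_n -> 'I_(2 * K).+1} * 'I_m.+1) : lattice n.+1 :=
  line_point (2 * (g.2 : nat)%:Z - m%:Z + modz (m%:Z + \sum_i p g.1 i) 2)
    (p g.1).
have -> : ((2 * K).+1 ^ n * m.+1 =
    #|{: {ffun 'I_n -> 'I_(2 * K).+1} * 'I_m.+1}|)%N.
  by rewrite card_prod card_ffun !card_ord.
apply: (@card_fset_set_leq _ _ _ f) => x [[dx x2] xm].
have xp (i : 'I_n) : exists g : 'I_(2 * K).+1,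
    ((g : nat)%:Z - K%:Z) * d%:Z = x 0 (lift ord0 i).
  have /dvdzP[q xq] := dx i; have := xm (lift ord0 i); rewrite xq => qm.
  have qK : (`|q| <= K)%N by rewrite leq_divRL//; have := abszM q d; lia.
  have gK : (`|(q + K%:Z)%R| < (2 * K).+1)%N by lia.
  exists (Ordinal gK) => /=; rewrite gez0_abs ?addrK//; lia.
have /choice[g gx] := xp.
have g2m : (`|divz (x 0%R ord0 + m%:Z)%R 2| < m.+1)%N.
  by have := xm ord0; move: (x 0 ord0) => x0; lia.
exists ([ffun i => g i], Ordinal g2m) => //.
have pg : p [ffun i => g i] =1 fun i => x 0 (lift ord0 i).
  by move=> i; rewrite /p ffunE.
apply/rowP => i; rewrite /f /=; case: (unliftP ord0 i) => [j|] ->.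
  by rewrite line_pointS pg.
rewrite line_point0; under eq_bigr do rewrite pg.
have := xm ord0; move: x2; rewrite big_ord_recl.
move: (\sum_(j < n) _) (x 0 ord0) => S x0; lia.
Qed.

Lemma le_limn_esup_cvg (R : realType) (u v : (\bar R)^nat) (l : \bar R) :
  (forall m, (u m <= v m)%E) -> v @ \oo --> l -> (limn_esup u <= l)%E.
Proof.
move=> uv vl; have [_ <-] := cvg_limn_einf_sup vl; rewrite !limn_esup_lim.
apply: lee_lim; [exact: is_cvg_esups|exact: is_cvg_esups|].
apply: nearW => m; apply: ge_ereal_sup => _ [k mk <-].
by apply: le_ereal_sup_tmp; exists (v k) => //; exists k.
Qed.

Lemma density_line_code (R : realType) n d : (0 < d)%N ->
  (density R (@line_code n d) <= ((2 * d%:R ^+ n)^-1)%:E)%E.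
Proof.
move=> d0; have d0R : 0 < d%:R :> R by rewrite ltr0n.
(* At x = 1/(m + 1), [b] dominates the ratio of the counts, because (2 K + 1)/(2 m + 1) <= (1 + (d -
   1) x)/d for K = [m %/ d], and (m + 1)/(2 m + 1) <= (1 + x)/2. Its value at 0 is the claimed
   density. *)
pose b (x : R) := (1 + (d%:R - 1) * x) ^+ n * (1 + x) / (2 * d%:R ^+ n).
apply: (@le_limn_esup_cvg _ _ (fun m => (b (harmonic m))%:E)) => [m|].
  rewrite lee_fin /b /=.
  have box0 : 0 < (#|` fset_set (@box n.+1 m)|)%:R :> R.
    by rewrite ltr0n (leq_trans _ (card_box_ge n.+1 m))// expn_gt0.
  rewrite ler_pdivrMr//.
  have : ((2 * m).+1 ^ n.+1)%:R <= (#|` fset_set (@box n.+1 m)|)%:R :> R.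
    by rewrite ler_nat card_box_ge.
  have : (#|` fset_set (@line_code n d `&` @box n.+1 m)|)%:R <=
      ((2 * (m %/ d)).+1 ^ n * m.+1)%:R :> R.
    by rewrite ler_nat card_line_code_box.
  move=> /le_trans le1 le2; apply: le1.
  set c := (X in _ <= X * _).
  have dh0 : 0 <= 1 + (d%:R - 1) * m.+1%:R^-1 :> R.
    by rewrite addr_ge0 ?mulr_ge0 ?subr_ge0 ?ler1n.
  have c0 : 0 <= c.
    apply: divr_ge0; last by rewrite mulr_ge0 ?exprn_ge0.
    by rewrite mulr_ge0 ?(exprn_ge0 _ dh0)// addr_ge0 ?invr_ge0.
  apply: le_trans (ler_wpM2l c0 le2).
  have h0 : 0 < m.+1%:R :> R by rewrite ltr0n.
  (* One factor 2 m + 1 goes to each coordinate, so that the bound can be compared coordinate by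
     coordinate. *)
  have -> : c * ((2 * m).+1 ^ n.+1)%:R =
      ((1 + (d%:R - 1) * m.+1%:R^-1) / d%:R * (2 * m).+1%:R) ^+ n *
      ((1 + m.+1%:R^-1) / 2 * (2 * m).+1%:R).
    by rewrite /c natrX exprSr !exprMn exprVn invfM; ring.
  rewrite natrM natrX; apply: ler_pM; rewrite ?exprn_ge0//.
    apply: lerXn2r; rewrite ?nnegrE//.
      by rewrite !mulr_ge0 ?invr_ge0.
    have Kd : (m %/ d)%:R * d%:R <= m%:R :> R.
      by rewrite -natrM ler_nat leq_trunc_div.
    have d1 : 1 <= d%:R :> R by rewrite ler1n.
    rewrite mulrAC ler_pdivlMr// -(ler_pM2r h0).
    rewrite [leRHS](_ : _ = (m.+1%:R + (d%:R - 1)) * (2 * m).+1%:R); last first.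
      by field; rewrite gt_eqF.
    rewrite -!natr1 !natrM in h0 *.
    have : 0 <= m%:R :> R by [].
    move: ((m %/ d)%:R : R) (m%:R : R) (d%:R : R) Kd d1 h0 => K M e; nra.
  rewrite -(ler_pM2r h0).
  rewrite [leRHS](_ : _ = (m.+1%:R + 1) / 2 * (2 * m).+1%:R); last first.
    by field; rewrite gt_eqF.
  rewrite -[m.+1%:R]natr1 -[(2 * m).+1%:R]natr1 natrM.
  have : 0 <= m%:R :> R by [].
  move: (m%:R : R) => M; nra.
have -> : (2 * d%:R ^+ n)^-1 = b 0 by rewrite /b mulr0 addr0 expr1n !mul1r.
apply: cvg_EFin; first exact: nearW.
apply: cvgM; last exact: cvg_cst.
apply: cvgM; last by apply: cvgD; [exact: cvg_cst|exact: cvg_harmonic].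
have dh : 1 + (d%:R - 1) * harmonic m @[m --> \oo] --> (1 + (d%:R - 1) * 0 : R).
  by apply: cvgD; [|apply: cvgM; [|exact: cvg_harmonic]]; exact: cvg_cst.
exact: (continuous_cvg _ (@exprn_continuous R n _) dh).
Qed.

(** In dimension n + 1 the equation on [d] turns the bound into 1/(2 d^n), the density of
    [line_code]. The code identifies because (n + 1) d < (n + 3) d = 2 (r - k) <= 2 r. *)
Lemma min_density_le (R : realType) n d r k :
    (0 < d)%N -> (k <= r)%N -> (n.+3 * d = 2 * (r - k))%N ->
  (min_density R n.+1 r <=
    ((n.+1%:R + 2) ^+ n / (2 ^+ n.+1 * (r%:R - k%:R) ^+ n))%:E)%E.
Proof.
move=> d0 kr rk; have dR : d%:R != 0 :> R by rewrite pnatr_eq0 -lt0n.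
have nR : n.+3%:R != 0 :> R by rewrite pnatr_eq0.
have -> : r%:R - k%:R = n.+3%:R * d%:R / 2 :> R.
  by rewrite -natrB// -natrM rk natrM mulrAC mulfV ?mul1r ?pnatr_eq0.
have -> : n.+1%:R + 2 = n.+3%:R :> R by rewrite -natrD addn2.
have -> : n.+3%:R ^+ n / (2 ^+ n.+1 * (n.+3%:R * d%:R / 2) ^+ n) =
    (2 * d%:R ^+ n)^-1 :> R.
  by rewrite !exprMn exprVn exprS; field; rewrite !expf_neq0.
apply: le_trans (density_line_code R n d0); apply: ereal_inf_lbound.
by exists (@line_code n d) => //=; apply: line_code_identifying => //; nia.
Qed.

Theorem theorem6 (R : realType) (n r k : nat) (hn : (1 <= n)%N) (hr : (1 <= r)%N) :
  (odd n -> (0 <= k < n + 2)%N -> (n + 2 <= r)%N -> r = k %[mod n + 2] ->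
    (min_density R n r <=
      ((n%:R + 2) ^+ (n - 1) / (2 ^+ n * (r%:R - k%:R) ^+ (n - 1)))%:E)%E)
  /\
  (~~ odd n -> (0 <= k < (n + 2) %/ 2)%N -> ((n + 2) %/ 2 <= r)%N ->
    r = k %[mod (n + 2) %/ 2] ->
    (min_density R n r <=
      ((n%:R + 2) ^+ (n - 1) / (2 ^+ n * (r%:R - k%:R) ^+ (n - 1)))%:E)%E).
Proof.
have modP M : (0 < M)%N -> (k < M)%N -> (M <= r)%N -> r = k %[mod M] ->
    exists2 e, (0 < e)%N & r = (e * M + k)%N.
  move=> M0 kM Mr; rewrite (modn_small kM) => rk.
  by exists (r %/ M)%N; [rewrite divn_gt0|rewrite -rk -divn_eq].
case: n hn modP => // n _ modP; rewrite subn1; split=> n_odd /andP[_ kM] Mr rk.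
  have [|e e0 re] := modP _ _ kM Mr rk; first by lia.
  (* In odd dimension r - k is [e] times the dimension plus 2, so the spacing is 2 e. In even
     dimension the modulus is half as large and the spacing is [e]. *)
  by apply: (@min_density_le R n (2 * e)); lia.
have [|e e0 re] := modP _ _ kM Mr rk; first by lia.
apply: (@min_density_le R n e) => //; first by lia.
by rewrite re addnK mulnCA mulnC; congr (_ * _)%N; move: n_odd; lia.
Qed.
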